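(* Let $a,b\in\mathbb{R}$ with $a\neq 0$. Let $M\subset\mathbb{R}^3$ be a rotational linear Weingarten surface, i.e. a surface of revolution whose principal curvatures satisfy $\kappa_1=a\kappa_2+b$, and let $\gamma(s)=(x(s),0,z(s))$ be its generating curve, parametrized by arc length with angle function $\theta$. Assume that $\gamma$ is not a geodesic (straight line). Then: 1. If $a\neq 1$, $\gamma$ is an extremal curve (under arbitrary boundary conditions) of $$\mathcal{F}^{\mu *}_p(\gamma)=\int_0^L\left(\theta'(s)-\mu\right)^p\,ds\quad\text{for}\quad \mu=\frac{-b}{a-1},\quad p=\frac{a}{a-1}.$$ 2. If $a=1$ and $b\neq 0$, then $\gamma$ satisfies the Euler-Lagrange equation of $$\mathcal{F}_\nu(\gamma)=\int_0^L e^{\nu\theta'(s)}\,ds\quad\text{for}\quad \nu=\frac1b .$$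
   Context: Surface of revolution: the axis is the $z$-axis and the generating curve $\gamma(s)=(x(s),0,z(s))$, $s\in I\subset\mathbb{R}$, lies in the $xz$-plane, is parametrized by arc length, and $x'(s)=\cos\theta(s)$, $z'(s)=\sin\theta(s)$ for a function $\theta$. The surface is parametrized by $X(s,\phi)=(x(s)\cos\phi,x(s)\sin\phi,z(s))$ and its principal curvatures are $\kappa_1(s)=\theta'(s)$ (the curvature of the profile curve) and $\kappa_2(s)=\sin\theta(s)/x(s)$ (the normal curvature of the orbits of the rotation). Hence $\kappa_1=a\kappa_2+b$ is equivalent to the system $x'=\cos\theta$, $z'=\sin\theta$, $\theta'=a\sin\theta/x+b$. Functionals: $\mathbb{R}^2$ is identified with the $xz$-plane; $s$ is arc length, $L$ the length of the curve and $\theta'$ its curvature. $\Omega_{p_0p_1}$ is the space of smooth regular curves in $\mathbb{R}^2$ joining two fixed points $p_0,p_1$, and $\Omega^*_{p_0p_1}$ is the subspace of those curves satisfying $|\gamma''|>\mu$. The functional $\mathcal{F}^{\mu *}_p$ ($p\neq 0,1$) acts on $\Omega^*_{p_0p_1}$, and $\mathcal{F}_\nu$ ($\nu\neq 0$) acts on $\Omega_{p_0p_1}$. The Euler-Lagrange equation of $\mathcal{F}^{\mu *}_p$ is $$\frac{d^2}{ds^2}\left((\theta'-\mu)^{p-1}\right)+(\theta')^2(\theta'-\mu)^{p-1}-\frac{\theta'}{p}(\theta'-\mu)^p=0,$$ and that of $\mathcal{F}_\nu$ is $$\frac{d^2}{ds^2}\left(e^{\nu\theta'}\right)+(\theta')^2e^{\nu\theta'}-\frac{\theta'}{\nu}e^{\nu\theta'}=0.$$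 Being an extremal curve under arbitrary boundary conditions means satisfying the Euler-Lagrange equation. In part 1, when $\theta'$ is constant one has $\theta'\equiv\mu$, and extremality is then understood in the sense that $\gamma$ is a global minimum of $\mathcal{F}^{\mu *}_p$ acting on a space of curves for which $(\theta'-\mu)^p$ is $L^1$-integrable.
   Formalization: For 0<a<1 (so p<0) and θ' constantly μ the integrand (θ'-μ)^p is undefined and is read as 0; where θ'<μ powers are principal complex values; the global minimum is over curves with θ'≥μ and integrable (θ'-μ)^p, for each compact subarc. *)

(* Defs.v *)
From HB Require Import structures.
From mathcomp Require Import all_boot all_order all_algebra.
From mathcomp Require Import all_classical all_reals all_analysis.
From mathcomp Require Import complex ring.
Set Implicit Arguments.
Unset Strict Implicit.
Unset Printing Implicit Defensive.
Import Order.TTheory GRing.Theory Num.Theory numFieldNormedType.Exports.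
Local Open Scope ring_scope.
Local Open Scope classical_set_scope.

(* The plane curve s |-> (x s, z s) on I, read in the xz-plane, is parametrized
   by arc length with angle function theta. *)
Record arclength_curve (R : realType) (I : set R) (x z theta : R -> R) : Prop :=
  ArclengthCurve {
    curve_x : forall s, I s -> is_derive s 1 x (cos (theta s));
    curve_z : forall s, I s -> is_derive s 1 z (sin (theta s));
    curve_theta : forall s, I s -> derivable theta s 1 }.

Definition straight_line (R : realType) (I : set R) (x z : R -> R) : Prop :=
  exists x0 z0 u v : R, forall s, I s -> x s = x0 + s * u /\ z s = z0 + s * v.

Definition surface (R : realType) (x z : R -> R) (s phi : R) : 'rV[R]_3 :=
  \row_i [:: x s * cos phi; x s * sin phi; z s]`_i.

Definition unit_normal (R : realType) (theta : R -> R) (s phi : R) : 'rV[R]_3 :=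
  \row_i [:: - (sin (theta s) * cos phi); - (sin (theta s) * sin phi);
             cos (theta s)]`_i.

Definition kappa1 (R : realType) (theta : R -> R) (s : R) : R := derive1 theta s.

Definition kappa2 (R : realType) (x theta : R -> R) (s : R) : R :=
  sin (theta s) / x s.

(* Away from the axis, kappa1 and kappa2 are the eigenvalues of the shape
   operator - dN of the surface, in the directions of the profile curve and of
   the orbits; see Rodrigues' equations in [rodrigues_profile] and
   [rodrigues_orbit]. *)
Definition linear_Weingarten (R : realType) (I : set R) (a b : R)
    (x theta : R -> R) : Prop :=
  forall s, I s -> x s != 0 /\ kappa1 theta s = a * kappa2 x theta s + b.

Lemma rodrigues_profile (R : realType) (I : set R) (x z theta : R -> R)
    (s phi : R) (i : 'I_3) :
  arclength_curve I x z theta -> I s ->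
  derive1 (fun u => unit_normal theta u phi 0 i) s =
  - kappa1 theta s * derive1 (fun u => surface x z u phi 0 i) s.
Proof.
case=> cx cz ct Is; rewrite /kappa1.
have dx := cx s Is; have dz := cz s Is.
have dt : is_derive s 1 theta (derive1 theta s).
  by rewrite derive1E; apply: derivableP; exact: ct.
have dsin := is_derive1_comp (is_derive_sin (theta s)) dt.
have dcos := is_derive1_comp (is_derive_cos (theta s)) dt.
have dM (f : R -> R) df c : is_derive s 1 f df ->
    derive1 (fun u => f u * c) s = df * c.
  move=> fd; have := is_deriveM fd (is_derive_cst c s 1).
  move=> /@derive_val; rewrite -derive1E => ->.
  by rewrite scaler0 add0r [LHS]mulrC.
case: i => -[|[|[|//]]] ?.
- rewrite (_ : (fun u => unit_normal _ _ _ _ _) =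
    fun u => (sin \o theta) u * - cos phi); last first.
    by apply/funext=> u; rewrite mxE /= mulrN.
  rewrite (_ : (fun u => surface _ _ _ _ _ _) = fun u => x u * cos phi);
    last by apply/funext=> u; rewrite mxE.
  rewrite (dM _ _ _ dsin) (dM _ _ _ dx); ring.
- rewrite (_ : (fun u => unit_normal _ _ _ _ _) =
    fun u => (sin \o theta) u * - sin phi); last first.
    by apply/funext=> u; rewrite mxE /= mulrN.
  rewrite (_ : (fun u => surface _ _ _ _ _ _) = fun u => x u * sin phi);
    last by apply/funext=> u; rewrite mxE.
  rewrite (dM _ _ _ dsin) (dM _ _ _ dx); ring.
- rewrite (_ : (fun u => unit_normal _ _ _ _ _) = cos \o theta);
    last by apply/funext=> u; rewrite mxE.
  rewrite (_ : (fun u => surface _ _ _ _ _ _) = z);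
    last by apply/funext=> u; rewrite mxE.
  rewrite !derive1E (@derive_val _ _ _ _ _ _ _ dcos) (@derive_val _ _ _ _ _ _ _ dz).
  rewrite -derive1E; ring.
Qed.

Lemma rodrigues_orbit (R : realType) (x z theta : R -> R) (s phi : R)
    (i : 'I_3) :
  x s != 0 ->
  derive1 (fun v => unit_normal theta s v 0 i) phi =
  - kappa2 x theta s * derive1 (fun v => surface x z s v 0 i) phi.
Proof.
move=> x0; rewrite /kappa2.
have dM (f : R -> R) df c : is_derive phi 1 f df ->
    derive1 (fun u => c * f u) phi = c * df.
  move=> fd; have := is_deriveM (is_derive_cst c phi 1) fd.
  by move=> /@derive_val; rewrite -derive1E => ->; rewrite scaler0 addr0.
have dcos := is_derive_cos phi; have dsin := is_derive_sin phi.
case: i => -[|[|[|//]]] ?.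
- rewrite (_ : (fun u => unit_normal _ _ _ _ _) =
    fun u => - sin (theta s) * cos u); last first.
    by apply/funext=> u; rewrite mxE /= mulNr.
  rewrite (_ : (fun u => surface _ _ _ _ _ _) = fun u => x s * cos u);
    last by apply/funext=> u; rewrite mxE.
  by rewrite (dM _ _ _ dcos) (dM _ _ _ dcos); field.
- rewrite (_ : (fun u => unit_normal _ _ _ _ _) =
    fun u => - sin (theta s) * sin u); last first.
    by apply/funext=> u; rewrite mxE /= mulNr.
  rewrite (_ : (fun u => surface _ _ _ _ _ _) = fun u => x s * sin u);
    last by apply/funext=> u; rewrite mxE.
  by rewrite (dM _ _ _ dsin) (dM _ _ _ dsin); field.
- rewrite (_ : (fun u => unit_normal _ _ _ _ _) = cst (cos (theta s)));
    last by apply/funext=> u; rewrite mxE.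
  rewrite (_ : (fun u => surface _ _ _ _ _ _) = cst (z s));
    last by apply/funext=> u; rewrite mxE.
  by rewrite !derive1_cst mulr0.
Qed.

(* Principal value of the real power t ^ q, the branch exp (i pi q) |t| ^ q
   being taken for t < 0: the curvature of a solution may stay below mu, and
   powR is not a power function on negative numbers. *)
Definition cpow (R : realType) (t q : R) : R[i] :=
  if 0 <= t then Complex (t `^ q) 0
  else Complex (`|t| `^ q * cos (pi * q)) (`|t| `^ q * sin (pi * q)).

Lemma cpowM (R : realType) (t q : R) : t != 0 ->
  cpow t (q + 1) = Complex t 0 * cpow t q.
Proof.
move=> t0; rewrite /cpow; have [t_ge0|t_lt0] := leP 0 t.
  rewrite powRD ?t0 ?implybT// powRr1//.
  by apply/eqP; rewrite eq_complex /=; apply/andP; split; apply/eqP; ring.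
rewrite powRD ?normr_eq0 ?t0 ?implybT// powRr1// ltr0_norm//.
rewrite mulrDr mulr1 cosDpi sinDpi.
by apply/eqP; rewrite eq_complex /=; apply/andP; split; apply/eqP; ring.
Qed.

Definition derivable2 (R : realType) (f : R -> R) (s : R) : Prop :=
  (\forall u \near s, derivable f u 1) /\ derivable (derive1 f) s 1.

Definition cderivable2 (R : realType) (f : R -> R[i]) (s : R) : Prop :=
  derivable2 (fun u => complex.Re (f u)) s /\
  derivable2 (fun u => complex.Im (f u)) s.

Definition cderive2 (R : realType) (f : R -> R[i]) (s : R) : R[i] :=
  Complex (derive1n 2 (fun u => complex.Re (f u)) s)
          (derive1n 2 (fun u => complex.Im (f u)) s).

(* The condition kappa != mu is what gives a meaning to the powers, whatever
   the exponent. *)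
Definition Euler_Lagrange_power (R : realType) (mu p : R) (I : set R)
    (theta : R -> R) : Prop :=
  let kappa := derive1 theta in
  forall s, I s ->
    [/\ kappa s != mu,
        cderivable2 (fun u => cpow (kappa u - mu) (p - 1)) s &
        cderive2 (fun u => cpow (kappa u - mu) (p - 1)) s
        + Complex (kappa s ^+ 2) 0 * cpow (kappa s - mu) (p - 1)
        - Complex (kappa s / p) 0 * cpow (kappa s - mu) p = 0].

Definition Euler_Lagrange_exp (R : realType) (nu : R) (I : set R)
    (theta : R -> R) : Prop :=
  let kappa := derive1 theta in
  forall s, I s ->
    derivable2 (fun u => expR (nu * kappa u)) s /\
    derive1n 2 (fun u => expR (nu * kappa u)) s
    + kappa s ^+ 2 * expR (nu * kappa s)
    - kappa s / nu * expR (nu * kappa s) = 0.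

(* The curve has parameter interval [c, d], so its length is d - c.  Note that
   powR gives 0 `^ p = 0 for every p != 0, negative exponents included. *)
Definition functional_power (R : realType) (mu p c d : R) (theta : R -> R) : R :=
  \int[lebesgue_measure]_(s in `[c, d]) ((derive1 theta s - mu) `^ p).

(* Curves from P to Q, of arbitrary length, on which kappa - mu is nonnegative
   with an integrable p-th power. *)
Record integrable_arc (R : realType) (mu p : R) (P Q : R * R) (c d : R)
    (x z theta : R -> R) : Prop := IntegrableArc {
  arc_lt : c < d;
  arc_curve : arclength_curve `[c, d] x z theta;
  arc_source : (x c, z c) = P;
  arc_target : (x d, z d) = Q;
  arc_curvature : forall s, `[c, d] s -> mu <= derive1 theta s;
  arc_integrable : lebesgue_measure.-integrable `[c, d]
    (EFin \o (fun s => (derive1 theta s - mu) `^ p)) }.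

Definition global_minimum_power (R : realType) (mu p : R) (P Q : R * R)
    (c d : R) (x z theta : R -> R) : Prop :=
  integrable_arc mu p P Q c d x z theta /\
  forall (c' d' : R) (x' z' theta' : R -> R),
    integrable_arc mu p P Q c' d' x' z' theta' ->
    functional_power mu p c d theta <= functional_power mu p c' d' theta'.

Definition constant_curvature (R : realType) (I : set R) (theta : R -> R) : Prop :=
  exists k : R, forall s, I s -> derive1 theta s = k.

Definition extremal_power (R : realType) (mu p : R) (I : set R)
    (x z theta : R -> R) : Prop :=
  (~ constant_curvature I theta -> Euler_Lagrange_power mu p I theta) /\
  (constant_curvature I theta ->
    (forall s, I s -> derive1 theta s = mu) /\
    forall c d : R, c < d -> `[c, d] `<=` I ->
      global_minimum_power mu p (x c, z c) (x d, z d) c d x z theta).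

(* Main.v *)
Require Import Defs.
From mathcomp Require Import all_boot all_order all_algebra.
From mathcomp Require Import all_classical all_reals all_analysis.
From mathcomp Require Import complex ring.
Import Order.TTheory GRing.Theory Num.Theory numFieldNormedType.Exports.
Local Open Scope ring_scope.
Local Open Scope classical_set_scope.

(* The Codazzi equation kappa2' = (cos theta / x) (kappa1 - kappa2) turns
   kappa1 = a kappa2 + b into kappa1' = (cos theta / x) ((a - 1) kappa1 + b).
   Since x' = cos theta, this linear equation integrates to
   kappa1 - mu = K |x| ^ (a - 1) when a <> 1, and to exp (kappa1 / b) = k x when
   a = 1.  So the quantity differentiated twice in the Euler-Lagrange equation,
   (kappa1 - mu) ^ (p - 1) or exp (nu kappa1), is a constant multiple of x,
   and x'' = - kappa1 sin theta.  If kappa1 is constant, then either K = 0, or x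
   is constant and the profile is a straight line. *)

(** * Constancy and sign of differentiable functions on an interval *)

Section DerivativeOnInterval.
Context {R : realType} {I : set R}.
Hypothesis itvI : is_interval I.

Lemma is_interval_segment {c d s : R} : I c -> I d -> s \in `[c, d]%R -> I s.
Proof. by move=> Ic Id; rewrite in_itv/= => /itvI; exact. Qed.

Lemma is_derive_within_continuous (f df : R -> R) (c d : R) :
  (forall s, I s -> is_derive s 1 f (df s)) -> I c -> I d ->
  {within `[c, d], continuous f}.
Proof.
move=> fE Ic Id; apply: derivable_within_continuous => s scd.
by have [] := fE s (is_interval_segment Ic Id scd).
Qed.

Lemma is_derive_0_is_interval_cst (f : R -> R) (s t : R) :
  (forall u, I u -> is_derive u 1 f 0) -> I s -> I t -> f s = f t.
Proof.
move=> f0; wlog st : s t / s <= t => [H Is It|Is It].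
  by case: (leP s t) => [/H|/ltW/H]; [exact | move=> ->].
have [|_ _ ] := @MVT_segment R f (fun=> 0) s t st _
    (is_derive_within_continuous f (fun=> 0) s t f0 Is It).
  by move=> u /subset_itv_oo_cc ust; exact/f0/(is_interval_segment Is It ust).
by rewrite mul0r => /eqP; rewrite subr_eq0 => /eqP.
Qed.

(** A sign change would produce a zero by the intermediate value theorem. Applied to [x], this makes
    [x s0 * x s] a positive substitute for the distance to the axis. *)
Lemma is_derive_neq0_sign_cst (f df : R -> R) (s t : R) :
  (forall u, I u -> is_derive u 1 f (df u)) -> (forall u, I u -> f u != 0) ->
  I s -> I t -> 0 < f s * f t.
Proof.
move=> fE f0; wlog st : s t / s <= t => [H Is It|Is It].
  by case: (leP s t) => [/H|/ltW/H H']; [exact | rewrite mulrC; exact: H'].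
rewrite ltNge; apply/negP => fst.
have [||u ust fu0] := @IVT R f s t 0 st.
- exact: is_derive_within_continuous fE Is It.
- rewrite ge_min le_max.
  case: (leP (f s) 0) => fs.
    have fs0 : f s < 0 by rewrite lt_neqAle f0.
    by move: fst; rewrite nmulr_rle0// => ->; rewrite orbT.
  by move: fst; rewrite pmulr_rle0// (ltW fs) => ->.
- by have := f0 u (is_interval_segment Is It ust); rewrite fu0 eqxx.
Qed.

End DerivativeOnInterval.

(** Multiplying [K] by the positive number [y ^ r] keeps it on the same branch of [cpow], so any
    complex phase stays in the factor coming from [K]. *)
Lemma cpow_powR_scale {R : realType} (K y r : R) : 0 < y -> r != 0 ->
  cpow (K * y `^ r) r^-1 = Complex y 0 * cpow K r^-1.
Proof.
move=> y0 r0; have yr : 0 < y `^ r by rewrite powR_gt0.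
have yrr : (y `^ r) `^ r^-1 = y by rewrite -powRrM mulfV// powRr1// ltW.
rewrite /cpow pmulr_lge0//; case: ifPn => [K0|_].
  rewrite powRM ?(ltW yr)// yrr.
  by apply/eqP; rewrite eq_complex /=; apply/andP; split; apply/eqP; ring.
rewrite normrM (gtr0_norm yr) powRM ?(ltW yr)// yrr.
by apply/eqP; rewrite eq_complex /=; apply/andP; split; apply/eqP; ring.
Qed.

(** * Derivatives along the profile curve *)

Section Profile.
Context {R : realType} {I : set R} {x z theta : R -> R}.
Hypothesis openI : open I.
Hypothesis curve : arclength_curve I x z theta.

Let kappa := derive1 theta.

Lemma near_open (P : R -> Prop) (s : R) :
  (forall t, I t -> P t) -> I s -> \forall t \near s, P t.
Proof.
by move=> IP Is; apply: filterS (open_nbhs_nbhs (conj openI Is)); exact: IP.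
Qed.

Lemma is_derive_theta (s : R) : I s -> is_derive s 1 theta (kappa s).
Proof.
move=> Is; rewrite /kappa derive1E; apply: derivableP.
exact: (curve_theta curve Is).
Qed.

Lemma is_derive_sin_theta (s : R) : I s ->
  is_derive s 1 (sin \o theta) (cos (theta s) * kappa s).
Proof.
by move=> Is; exact: is_derive1_comp (is_derive_sin _) (is_derive_theta s Is).
Qed.

Lemma is_derive_cos_theta (s : R) : I s ->
  is_derive s 1 (cos \o theta) (- sin (theta s) * kappa s).
Proof.
by move=> Is; exact: is_derive1_comp (is_derive_cos _) (is_derive_theta s Is).
Qed.

(** As [I] is open, [f] and [k * x] agree near each point and share their derivatives. No power or
    exponential of the curvature then has to be differentiated twice. *)
Lemma profile_multiple_derive2 (f : R -> R) (k s : R) :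
  (forall t, I t -> f t = k * x t) -> I s ->
  derivable2 f s /\ derive1n 2 f s = - (k * sin (theta s) * kappa s).
Proof.
move=> fE Is.
have df t : I t -> is_derive t 1 f (k * cos (theta t)).
  move=> It; apply: (@near_eq_is_derive _ _ _ (k \*: x)).
    by apply: near_open It => u /fE ->.
  by have := is_deriveZ k (curve_x curve It).
have ddf : is_derive s 1 (derive1 f) (k * (- sin (theta s) * kappa s)).
  apply: (@near_eq_is_derive _ _ _ (k \*: (cos \o theta))).
    by apply: near_open Is => u /df fu; rewrite derive1E derive_val.
  exact: is_deriveZ (is_derive_cos_theta s Is).
split; last by rewrite /= derive1E derive_val; ring.
split; last by case: ddf.
by apply: near_open Is => u /df [].
Qed.

Hypothesis itvI : is_interval I.

(** The derivative of [sin theta] has the factor [cos theta], so [sin theta] is constant too and the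
    velocity is a fixed vector. *)
Lemma cos_theta0_straight_line :
  (forall s, I s -> cos (theta s) = 0) -> straight_line I x z.
Proof.
move=> cos0; have [[s0 Is0]|I0] := pselect (exists s, I s); last first.
  by exists 0, 0, 0, 0 => s Is; case: I0; exists s.
have sinE s : I s -> sin (theta s) = sin (theta s0).
  move=> Is; apply: (is_derive_0_is_interval_cst itvI (sin \o theta) s s0) => // u Iu.
  by apply: is_derive_eq (is_derive_sin_theta u Iu) _; rewrite cos0 ?mul0r.
pose v := sin (theta s0).
exists (x s0), (z s0 - s0 * v), 0, v => s Is; split.
  rewrite mulr0 addr0; apply: (is_derive_0_is_interval_cst itvI) => // u Iu.
  by apply: is_derive_eq (curve_x curve Iu) _; exact: cos0.
suff /eqP : z s - v * s = z s0 - v * s0.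
  by rewrite subr_eq => /eqP ->; ring.
apply: (is_derive_0_is_interval_cst itvI (z - v \*: id)) => // u Iu.
have := is_deriveB (curve_z curve Iu) (is_deriveZ v (is_derive_id u (1 : R))).
by move/is_derive_eq; apply; rewrite sinE// [_ *: _]mulr1 subrr.
Qed.

(** * Consequences of the Weingarten relation *)

Context {a b : R}.
Hypothesis weingarten : linear_Weingarten I a b x theta.

Lemma profile_neq0 (s : R) : I s -> x s != 0.
Proof. by move=> /weingarten[]. Qed.

Lemma weingarten_kappa (s : R) : I s -> kappa s = a * (sin (theta s) / x s) + b.
Proof. by move=> /weingarten[]. Qed.

(** Only [theta] is assumed differentiable; the Weingarten relation, valid near [s], is what makes
    [kappa] differentiable. *)
Lemma is_derive_kappa (s : R) : I s ->
  is_derive s 1 kappa (cos (theta s) / x s * ((a - 1) * kappa s + b)).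
Proof.
move=> Is; have x0 := profile_neq0 s Is.
apply: (@near_eq_is_derive _ _ _ (a \*: ((sin \o theta) * (fun t => (x t)^-1)) + cst b)).
  by apply: near_open Is => t It; rewrite weingarten_kappa.
have dV := is_deriveV x0 (curve_x curve Is).
have := is_deriveD (is_deriveZ a (is_deriveM (is_derive_sin_theta s Is) dV))
                   (is_derive_cst b s 1).
move/is_derive_eq; apply.
by rewrite /GRing.scale/= weingarten_kappa//; field.
Qed.

Lemma weingarten_first_integral : a != 1 -> exists K s0 : R, forall s, I s ->
  0 < x s0 * x s /\ kappa s - - b / (a - 1) = K * (x s0 * x s) `^ (a - 1).
Proof.
move=> a1; have a10 : a - 1 != 0 by rewrite subr_eq0.
have [[s0 Is0]|I0] := pselect (exists s, I s); last first.
  by exists 0, 0 => s Is; case: I0; exists s.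
have y0 s : I s -> 0 < x s0 * x s.
  move=> Is; exact: (is_derive_neq0_sign_cst itvI x (cos \o theta) s0 s
    (@curve_x _ _ _ _ _ curve) profile_neq0).
pose u s := kappa s - - b / (a - 1).
(* Integrating factor: [G] is [(kappa - mu) * (x s0 * x) ^ (1 - a)], and its constant value is the
   required [K]. *)
pose G := u * (expR \o (- (a - 1) \*: (@ln R \o (x s0 \*: x)))).
have dG s : I s -> is_derive s 1 G 0.
  move=> Is; have xs0 := profile_neq0 s Is; have xs00 := profile_neq0 s0 Is0.
  have dln := @is_derive1_comp _ _ (x s0 \*: x) s _ _ (is_derive1_ln (y0 s Is))
    (is_deriveZ (x s0) (curve_x curve Is)).
  have dexp := is_derive1_comp (is_derive_expR _) (is_deriveZ (- (a - 1)) dln).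
  have du := is_deriveB (is_derive_kappa s Is) (is_derive_cst (- b / (a - 1)) s 1).
  apply: is_derive_eq (is_deriveM du dexp) _.
  rewrite /GRing.scale/=; set E := expR _.
  rewrite (_ : (kappa - cst _) s = kappa s - - b / (a - 1))//.
  by field; rewrite a10 xs0 xs00.
exists (G s0), s0 => s Is; split; first exact: y0.
rewrite (is_derive_0_is_interval_cst itvI G s0 s dG Is0 Is).
rewrite /powR gt_eqF ?y0// /G /= -[LHS]mulr1 -[in RHS]mulrA; congr (_ * _).
rewrite -expRD -[LHS]expR0; congr expR; apply/esym.
by rewrite -[RHS](addNr ((a - 1) * ln (x s0 * x s))) -mulNr.
Qed.

Lemma weingarten_Euler_Lagrange_power : a != 0 -> a != 1 ->
  ~ constant_curvature I theta ->
  Euler_Lagrange_power (- b / (a - 1)) (a / (a - 1)) I theta.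
Proof.
move=> a0 a1 ncst; have a10 : a - 1 != 0 by rewrite subr_eq0.
have [K [s0 KE]] := weingarten_first_integral a1.
set mu := - b / (a - 1) in KE *; set p := a / (a - 1).
(* Raising to the power [p - 1] thus undoes the exponent [a - 1] of the first integral. *)
have pE : p - 1 = (a - 1)^-1 by rewrite /p; field.
have K0 : K != 0.
  apply/eqP => K0; apply: ncst; exists mu => s /KE[_].
  by rewrite K0 mul0r => /eqP; rewrite subr_eq0 => /eqP.
have umu s : I s -> kappa s - mu != 0.
  by move=> /KE[y0 ->]; rewrite mulf_neq0// gt_eqF// powR_gt0.
(* The complex power of [kappa - mu] is [x] times the constant [x s0 * K ^ (p - 1)], whose
   coordinates are [kr] and [ki]. *)
pose kr := x s0 * complex.Re (cpow K (a - 1)^-1).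
pose ki := x s0 * complex.Im (cpow K (a - 1)^-1).
have cE s : I s -> cpow (kappa s - mu) (p - 1) = Complex (kr * x s) (ki * x s).
  move=> /KE[y0 ->]; rewrite pE cpow_powR_scale// /kr /ki.
  case: (cpow K _) => cr ci.
  by apply/eqP; rewrite eq_complex /=; apply/andP; split; apply/eqP; ring.
move=> s Is; rewrite -/kappa.
have [dr ddr] := profile_multiple_derive2
  (fun t => complex.Re (cpow (kappa t - mu) (p - 1))) kr s
  (fun t It => congr1 (@complex.Re R) (cE t It)) Is.
have [di ddi] := profile_multiple_derive2
  (fun t => complex.Im (cpow (kappa t - mu) (p - 1))) ki s
  (fun t It => congr1 (@complex.Im R) (cE t It)) Is.
split; [by rewrite -subr_eq0 umu|exact: conj dr di|].
have cpE : cpow (kappa s - mu) p =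
    Complex (kappa s - mu) 0 * cpow (kappa s - mu) (p - 1).
  by rewrite -cpowM ?umu// subrK.
rewrite /cderive2 ddr ddi cpE cE//.
(* The equation is now linear in the multiple of [x], so one real identity with free [k] serves both
   coordinates. *)
have EL k : - (k * sin (theta s) * kappa s) + kappa s ^+ 2 * (k * x s)
    - kappa s / p * ((kappa s - mu) * (k * x s)) = 0.
  rewrite weingarten_kappa// /mu /p; field.
  by rewrite a0 a10 profile_neq0.
by apply/eqP; rewrite eq_complex /=; apply/andP; split; apply/eqP;
  [rewrite -[RHS](EL kr) | rewrite -[RHS](EL ki)]; ring.
Qed.

Lemma weingarten_constant_curvature : a != 1 -> ~ straight_line I x z ->
  constant_curvature I theta -> forall s, I s -> kappa s = - b / (a - 1).
Proof.
move=> a1 nline [k kE]; have a10 : a - 1 != 0 by rewrite subr_eq0.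
have [kmu|kmu] := eqVneq k (- b / (a - 1)); first by move=> s /kE; rewrite kmu.
case: nline; apply: cos_theta0_straight_line => s Is.
have dk : is_derive s 1 kappa 0.
  by apply: (@near_eq_is_derive _ _ _ (cst k)); apply: near_open Is => t /kE.
have := is_derive_kappa s Is => -[_].
(* With [kappa' = 0] the Codazzi equation leaves [cos theta = 0] or [(a - 1) * k + b = 0]; the
   latter is excluded by [k != mu]. *)
rewrite (derive_val (is_derive := dk)) => /esym/eqP.
rewrite !mulf_eq0 invr_eq0 (negbTE (profile_neq0 s Is)) orbF.
case/orP => [/eqP//|]; rewrite /kappa kE// => /eqP kb.
case/eqP: kmu; apply/(canRL (mulfK a10))/eqP.
by rewrite -subr_eq0 opprK mulrC kb.
Qed.

Lemma weingarten_Euler_Lagrange_exp : a = 1 -> b != 0 ->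
  Euler_Lagrange_exp (1 / b) I theta.
Proof.
move=> a1 b0; pose E := expR \o ((1 / b) \*: kappa).
(* First integral for [a = 1]: the quotient of [exp (kappa / b)] by [x] is constant. *)
pose G := E * (fun t => (x t)^-1).
have dG s : I s -> is_derive s 1 G 0.
  move=> Is; have x0 := profile_neq0 s Is.
  have dE := is_derive1_comp (is_derive_expR _)
    (is_deriveZ (1 / b) (is_derive_kappa s Is)).
  have dV := is_deriveV x0 (curve_x curve Is).
  apply: is_derive_eq (is_deriveM dE dV) _.
  by rewrite /E /GRing.scale/= a1; set e := expR _; field; rewrite b0 x0.
move=> s Is; rewrite -/kappa.
have EE t : I t -> expR (1 / b * kappa t) = G s * x t.
  move=> It; rewrite (is_derive_0_is_interval_cst itvI G s t dG Is It).
  by rewrite /G /E /= -[RHS]mulrA mulVf ?mulr1// profile_neq0.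
have [d2 d2E] := profile_multiple_derive2 _ (G s) s EE Is.
split=> //; rewrite d2E EE//; have x0 := profile_neq0 s Is.
by rewrite weingarten_kappa// a1; field; rewrite b0 x0.
Qed.

End Profile.

(** The integrand is [powR] of 0, which is 0 for every [p != 0], negative [p] included by
    convention. The functional is thus 0 on this curve, and it is nonnegative on every
    competitor. *)
Lemma global_minimum_power_curvature_mu {R : realType} (mu p c d : R)
    (x z theta : R -> R) :
  p != 0 -> c < d -> arclength_curve `[c, d] x z theta ->
  (forall s, `[c, d] s -> derive1 theta s = mu) ->
  global_minimum_power mu p (x c, z c) (x d, z d) c d x z theta.
Proof.
move=> p0 cd curve kE.
have pow0 : {in `[c, d], (fun s => (derive1 theta s - mu) `^ p) =1 cst 0}.
  by move=> s /set_mem scd /=; rewrite kE// subrr powR0.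
split.
  split=> //; first by move=> s /kE ->.
  apply: (@eq_integrable _ _ _ _ _ _ (cst 0%E)) => //; last exact: integrable0.
  by move=> s /pow0 /= ->.
move=> c' d' x' z' theta' _; rewrite /functional_power.
rewrite (@eq_Rintegral _ _ _ _ _ (cst 0)); last by move=> s /pow0.
rewrite Rintegral_cst// mul0r; apply: Rintegral_ge0 => s _.
exact: powR_ge0.
Qed.

Theorem theorem2p1 (R : realType) (I : set R) (a b : R) (x z theta : R -> R) :
  open I -> is_interval I -> a != 0 ->
  arclength_curve I x z theta ->
  linear_Weingarten I a b x theta ->
  ~ straight_line I x z ->
  (a != 1 ->
     extremal_power (- b / (a - 1)) (a / (a - 1)) I x z theta) /\
  (a = 1 -> b != 0 ->
     Euler_Lagrange_exp (1 / b) I theta).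
Proof.
move=> openI itvI a0 curve wein nline; split; last first.
  exact: (weingarten_Euler_Lagrange_exp openI curve itvI wein).
move=> a1; split.
  exact: (weingarten_Euler_Lagrange_power openI curve itvI wein a0 a1).
move=> kcst.
have kE := weingarten_constant_curvature openI curve itvI wein a1 nline kcst.
split; first exact: kE.
move=> c d cd cdI; apply: global_minimum_power_curvature_mu => //.
- by rewrite mulf_neq0// invr_eq0 subr_eq0.
- case: curve => cx cz ct.
  by split=> s /cdI Is; [exact: cx|exact: cz|exact: ct].
- by move=> s /cdI; exact: kE.
Qed.
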